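(* Let $D$ be a strongly connected tournament, let $\sigma=v_1,\dots,v_n$ be an ordering of $V(D)$, and suppose the feedback arc set $S$ with respect to $\sigma$ is a minimum feedback arc set of $D$ and the subdigraph $D_S$ arc-induced by $S$ is a directed star. Let $m$ be the number of (distinct) feedback intervals of $\sigma$ with respect to $S$, and let $k\ge 2$. Then $D$ is $k$-AW if and only if $\gcd(k,m)=1$.
   Context: A tournament is a digraph in which for every pair of distinct vertices $v,w$ exactly one of $vw$, $wv$ is an arc. Strongly connected: for any two vertices there are directed walks in both directions. For an ordering $\sigma=v_1,\dots,v_n$ of $V(D)$, the feedback arc set with respect to $\sigma$ is the set $S$ of arcs $v_jv_i\in A(D)$ with $i<j$; a minimum feedback arc set is a feedback arc set (with respect to some ordering) of minimum cardinality over all orderings. If $vw\in S$, $v$ is a tail feedback vertex and $w$ a head feedback vertex. For $B\subseteq A(D)$, the arc-induced subdigraph $D_B$ has arc set $B$ and vertex set the vertices incident with arcs of $B$. For $s,t\ge 0$, an $(s,t)$-directed star is a digraph with vertex set $\{v,u_1,\dots,u_s,w_1,\dots,w_t\}$ and arc set $\{u_iv, vw_j:1\le i\le s,1\le j\le t\}$; $v$ is its central vertex. A head feedback interval (resp. tail feedback interval) is a nonempty set of consecutive vertices $\{v_i,v_{i+1},\dots,v_j\}$ in $\sigma$ all of which are head (resp. tail) feedback vertices, such that neither $v_{i-1}$ nor $v_{j+1}$ (when they exist) is a head (resp. tail) feedback vertex. A feedback interval is a set that is a head feedback interval or a tail feedback interval (or both; a set that is both is counted once in $m$). The $k$-lights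 out game: start with a labeling $V(D)\to\mathbb{Z}_k$; toggling $v$ increases by $1$ mod $k$ the label of $v$ and of every $w$ with $vw\in A(D)$; the game is won when all labels are $0$. $D$ is $k$-AW if every labeling $V(D)\to\mathbb{Z}_k$ can be brought to the all-zero labeling by toggling. *)

(* Defs.v *)
From mathcomp Require Import all_boot all_order all_algebra.
Set Implicit Arguments. Unset Strict Implicit. Unset Printing Implicit Defensive.
Import GRing.Theory.

(* A digraph on the finite vertex type T is given by its arc relation A. *)
Section Defs.
Variable T : finType.
Variable A : rel T.

Definition tournament : Prop :=
  (forall v, ~~ A v v) /\
  (forall v w, v != w -> (A v w (+) A w v)).

Definition strongly_connected : Prop := forall v w, connect A v w.

(* an ordering of V(D): a duplicate-free list containing every vertex;
   the position of x is index x sigma (0-based) *)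
Definition is_ordering (sigma : seq T) : Prop := uniq sigma /\ (forall x, x \in sigma).

Definition fas (sigma : seq T) : {set T * T} :=
  [set e | A e.1 e.2 && (index e.2 sigma < index e.1 sigma)].

Definition min_fas (sigma : seq T) : Prop :=
  forall tau, is_ordering tau -> #|fas sigma| <= #|fas tau|.

(* the arc-induced subdigraph D_B is (isomorphic to) an (s,t)-directed star for
   some s,t: there is a central vertex c belonging to V(D_B) such that every arc
   of B has exactly one endpoint equal to c, and no vertex is both an in- and an
   out-neighbour of c (the u_i and w_j are distinct). *)
Definition directed_star (B : {set T * T}) : Prop :=
  exists c : T,
    [/\ exists2 e, e \in B & ((e.1 == c) || (e.2 == c)),
        forall e, e \in B -> (e.1 == c) (+) (e.2 == c)
      & forall x, ~ ((x, c) \in B /\ (c, x) \in B)].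

Definition head_fv (S : {set T * T}) (w : T) : bool := [exists v, (v, w) \in S].
Definition tail_fv (S : {set T * T}) (v : T) : bool := [exists w, (v, w) \in S].

Definition p_interval (sigma : seq T) (p : pred T) (I : {set T}) : bool :=
  [exists i : 'I_(size sigma), exists j : 'I_(size sigma),
     [&& i <= j,
         I == [set x | (i <= index x sigma) && (index x sigma <= j)],
         [forall x in I, p x],
         [forall x, ((index x sigma).+1 == i) ==> ~~ p x]
       & [forall x, (index x sigma == j.+1) ==> ~~ p x]]].

Definition feedback_interval (sigma : seq T) (I : {set T}) : bool :=
  p_interval sigma (head_fv (fas sigma)) I || p_interval sigma (tail_fv (fas sigma)) I.

Definition num_feedback_intervals (sigma : seq T) : nat :=
  #|[set I : {set T} | feedback_interval sigma I]|.

Definition toggle (k : nat) (f : T -> 'Z_k) (v : T) : T -> 'Z_k :=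
  fun w => if (w == v) || A v w then (f w + 1)%R else f w.

Definition kAW (k : nat) : Prop :=
  forall f : T -> 'Z_k, exists s : seq T, forall w, foldl (@toggle k) f s w = 0%R.

End Defs.

(* Main.v *)
Require Import Defs.
From mathcomp Require Import all_boot all_order all_algebra.
From mathcomp Require Import all_fingroup zify ring.

Set Implicit Arguments.
Unset Strict Implicit.
Unset Printing Implicit Defensive.
Import GRing.Theory.

(** Toggling each vertex [v] a total of [x v] times adds to the label of [w] the
sum of [x w] and of the [x v] over the arcs [v -> w], so being [k]-AW means that
this linear endomorphism of ['Z_k ^ T] is onto. Let [c] be the centre of the
star. For [w <> c] the sum is the prefix sum of [x] up to [w], plus [x c] if
[c -> w] is a feedback arc and minus [x c] if [w -> c] is one. If it vanishes
for all [w <> c], every prefix sum away from [c] is [0] or [+- x c], hence each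
maximal run of leaves contributes exactly [x c] to the sum at [c], which is then
[m * x c]. Minimality of the feedback arc set is used only to see that no
neighbour of [c] in the ordering is a leaf, so that [c] is an interval by itself
and [m] is the number of runs of leaves plus one. *)

(** * Maximal runs of consecutive vertices in an ordering *)

Section Ordering.
Variables (T : finType) (sigma : seq T).
Hypothesis ord_sigma : is_ordering sigma.
Local Notation pos x := (index x sigma).

Lemma pos_inj : injective (fun x => pos x).
Proof.
move=> x y /= e; case: ord_sigma => _ h.
by rewrite -(nth_index x (h x)) e nth_index.
Qed.

Lemma pos_lt x : pos x < size sigma.
Proof. by case: ord_sigma => _ h; rewrite index_mem. Qed.

Lemma exists_pos n : n < size sigma -> exists y, pos y = n.
Proof.
case: ord_sigma => u h ln.
have x0 : T by case: sigma ln.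
by exists (nth x0 sigma n); rewrite index_uniq.
Qed.

Definition run_start (q : pred T) w :=
  q w && ~~ [exists y, q y && ((pos y).+1 == pos w)].

Definition run (q : pred T) w : {set T} :=
  [set x | (pos w <= pos x) && [forall y, (pos w <= pos y <= pos x) ==> q y]].

Lemma mem_run (q : pred T) w : q w -> w \in run q w.
Proof.
move=> qw; rewrite inE leqnn; apply/forallP => y; apply/implyP => h.
by have <- : w = y by apply: pos_inj => /=; lia.
Qed.

Lemma run_inj q : {in run_start q &, injective (run q)}.
Proof.
move=> v w /andP[qv _] /andP[qw _] e; apply: pos_inj => /=.
have := mem_run qv; rewrite e inE => /andP[h1 _].
have := mem_run qw; rewrite -e inE => /andP[h2 _].
by lia.
Qed.

(** An interval is determined by its first vertex, so intervals can be counted by their starting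
    points. *)
Lemma p_interval_runs q :
  [set I | p_interval sigma q I] = run q @: [set w | run_start q w].
Proof.
apply/setP => I; rewrite inE; apply/idP/imsetP.
  case/existsP => i /existsP[j /and5P[lij /eqP eI /forallP qI /forallP bl /forallP br]].
  have [w pw] := exists_pos (ltn_ord i).
  exists w.
    rewrite inE; apply/andP; split.
      by apply: (implyP (qI w)); rewrite eI inE pw leqnn.
    apply/existsPn => y; apply/negP => /andP[qy /eqP ey].
    by have /implyP := bl y; rewrite ey pw eqxx qy => /(_ isT).
  apply/setP => x; rewrite eI !inE pw; apply/idP/idP.
    case/andP => h1 h2; rewrite h1 /=; apply/forallP => y; apply/implyP => h.
    by apply: (implyP (qI y)); rewrite eI inE; lia.
  case/andP => h1 /forallP h2; rewrite h1 /= leqNgt; apply/negP => lt.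
  have [y py] := exists_pos (leq_ltn_trans lt (pos_lt x)).
  have := implyP (br y); rewrite py eqxx => /(_ isT).
  by have /implyP -> := h2 y => //; rewrite py; lia.
case=> w; rewrite inE => /andP[qw /existsPn sw] ->.
have wR := mem_run qw.
(* The last vertex [z] of the run supplies the right endpoint of the interval. *)
have [z zR zmax] := @arg_maxnP _ w (fun u => u \in run q w) (fun u => pos u) wR.
have {}zmax u : u \in run q w -> pos u <= pos z := zmax u.
have [lwz /forallP qwz] : pos w <= pos z /\ [forall y, (pos w <= pos y <= pos z) ==> q y].
  by move: zR; rewrite inE => /andP.
apply/existsP; exists (Ordinal (pos_lt w)); apply/existsP; exists (Ordinal (pos_lt z)).
apply/and5P; split => //=.
- apply/eqP/setP => x; apply/idP/idP => [xR|].
    by rewrite inE (zmax x xR) andbT; move: xR; rewrite inE => /andP[].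
  rewrite !inE => /andP[h1 h2]; rewrite h1 /=; apply/forallP => y; apply/implyP => h.
  by apply: (implyP (qwz y)); lia.
- apply/forallP => x; apply/implyP; rewrite inE => /andP[h /forallP/(_ x)/implyP].
  by apply; rewrite h leqnn.
- apply/forallP => x; apply/implyP => /eqP ex; apply/negP => qx.
  by have := sw x; rewrite qx ex eqxx.
- apply/forallP => x; apply/implyP => /eqP ex; apply/negP => qx.
  suff /zmax : x \in run q w by rewrite ex /=; lia.
  rewrite inE; apply/andP; split; first by lia.
  apply/forallP => y; apply/implyP => h.
  have [/eqP e|ne] := boolP (pos y == pos x); first by rewrite (pos_inj e).
  by apply: (implyP (qwz y)); move/eqP: ne; lia.
Qed.

Lemma card_p_interval q :
  #|[set I | p_interval sigma q I]| = #|[set w | run_start q w]|.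
Proof.
rewrite p_interval_runs card_in_imset // => v w; rewrite !inE.
exact: run_inj.
Qed.

Definition adjacent x y := (pos x == (pos y).+1) || (pos y == (pos x).+1).

(** When [r] implies [q], this says that [r] is a union of maximal runs of [q]. *)
Definition adjacent_closed (q r : pred T) :=
  forall x y, r y -> q x -> adjacent x y -> r x.

Lemma p_interval_closed_sub (q r : pred T) I :
  (forall x, r x -> q x) -> adjacent_closed q r ->
  p_interval sigma r I -> p_interval sigma q I.
Proof.
move=> rq cl /existsP[i /existsP[j]].
case/and5P=> [lij /eqP eI /forallP rI /forallP bl /forallP br].
apply/existsP; exists i; apply/existsP; exists j; apply/and5P; split => //.
- by rewrite eI.
- by apply/forallP => x; apply/implyP => /(implyP (rI x)); apply: rq.
- apply/forallP => x; apply/implyP => ex; apply/negP => qx.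
  have := implyP (bl x) ex; apply/negP; rewrite negbK.
  have [w pw] := exists_pos (ltn_ord i).
  apply: (@cl x w) => //; last by rewrite /adjacent pw; move/eqP: ex => ->; rewrite eqxx orbT.
  by apply: (implyP (rI w)); rewrite eI inE pw leqnn.
- apply/forallP => x; apply/implyP => ex; apply/negP => qx.
  have := implyP (br x) ex; apply/negP; rewrite negbK.
  have [w pw] := exists_pos (ltn_ord j).
  apply: (@cl x w) => //; last by rewrite /adjacent pw ex.
  by apply: (implyP (rI w)); rewrite eI inE pw leqnn andbT.
Qed.

Lemma p_interval_closed_sup (q r : pred T) I x :
  (forall x, r x -> q x) -> adjacent_closed q r ->
  p_interval sigma q I -> x \in I -> (forall y, y \in I -> pos x <= pos y) ->
  r x -> p_interval sigma r I.
Proof.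
move=> rq cl /existsP[i /existsP[j]].
case/and5P=> [lij /eqP eI /forallP qI /forallP bl /forallP br] xI xmin rx.
apply/existsP; exists i; apply/existsP; exists j; apply/and5P; split => //.
- by rewrite eI.
(* Membership in [r] spreads rightwards from the first vertex [x], one position at a time. *)
- have H n : forall y, y \in I -> pos y = pos x + n -> r y.
    elim: n => [|n IH] y yI ey.
      by have -> : y = x by apply: pos_inj => /=; lia.
    have [z pz] : exists z, pos z = pos x + n.
      by apply: exists_pos; apply: ltn_trans (pos_lt y); lia.
    apply: (@cl y z); last by rewrite /adjacent; lia.
      apply: IH => //; move: xI yI; rewrite eI !inE; lia.
    exact: (implyP (qI y)).
  apply/forallP => y; apply/implyP => yI.
  by apply: (H (pos y - pos x)) => //; have := xmin y yI; lia.
- apply/forallP => y; apply/implyP => ey; apply/negP => ry.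
  by have := implyP (bl y) ey; rewrite rq.
- apply/forallP => y; apply/implyP => ey; apply/negP => ry.
  by have := implyP (br y) ey; rewrite rq.
Qed.

(** Each maximal run of the union lies wholly in [r1] or wholly in [r2], according to its first
    vertex. Head and tail intervals can thus be counted together, a set that is both being counted
    once. *)
Lemma p_intervalU (r1 r2 : pred T) I :
  adjacent_closed (fun x => r1 x || r2 x) r1 -> adjacent_closed (fun x => r1 x || r2 x) r2 ->
  p_interval sigma r1 I || p_interval sigma r2 I = p_interval sigma (fun x => r1 x || r2 x) I.
Proof.
move=> c1 c2.
have s1 x : r1 x -> (r1 x || r2 x) by move=> ->.
have s2 x : r2 x -> (r1 x || r2 x) by move=> ->; rewrite orbT.
apply/idP/idP => [/orP[]|h]; first exact: p_interval_closed_sub.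
  exact: p_interval_closed_sub.
have /existsP[i /existsP[j /and5P[lij /eqP eI /forallP qI _ _]]] := h.
have [w pw] := exists_pos (ltn_ord i).
have wI : w \in I by rewrite eI inE pw leqnn.
have wmin y : y \in I -> pos w <= pos y by rewrite eI inE pw => /andP[].
have /orP[rw|rw] := implyP (qI w) wI; apply/orP; [left|right].
  exact: (p_interval_closed_sup s1 c1 h wI wmin rw).
exact: (p_interval_closed_sup s2 c2 h wI wmin rw).
Qed.

End Ordering.

(** Otherwise exchanging the consecutive vertices [a] and [b] would remove [(b, a)] from the
    feedback arc set and add nothing to it, against minimality. *)
Lemma min_fas_adjacent (T : finType) (A : rel T) (sigma : seq T) a b :
  tournament A -> is_ordering sigma -> min_fas A sigma ->
  index b sigma = (index a sigma).+1 -> ~~ A b a.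
Proof.
move=> [_ tA] os mn eab; apply/negP => Aba.
have [us hs] := os.
pose f := tperm a b.
pose tau := map f sigma.
have it x : index x tau = index (f x) sigma.
  by rewrite -{1}(tpermK a b x) index_map //; apply: perm_inj.
have ot : is_ordering tau.
  split; first by rewrite map_inj_uniq //; apply: perm_inj.
  by move=> x; rewrite -(tpermK a b x) map_f.
have := mn _ ot; apply/negP; rewrite -ltnNge.
have nab : b != a by apply/eqP => e; move: eab; rewrite e; lia.
have nAab : ~~ A a b by move: (tA _ _ nab); rewrite Aba /=.
have pinj u v : index u sigma = index v sigma -> u = v := @pos_inj _ _ os u v.
apply: proper_card; apply/properP; split.
  (* Any third vertex lies on the same side of both [a] and [b], before and after the exchange, and
     [(a, b)] is not an arc. *)
  apply/subsetP => -[x y]; rewrite !inE /= !it => /andP[Axy].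
  rewrite Axy /= /f; move: Axy.
  case: tpermP => [->|->|/eqP ya /eqP yb]; case: tpermP => [->|->|/eqP xa /eqP xb];
    rewrite ?(negbTE nAab) //; try lia.
    move=> _ h; have : index x sigma <> index b sigma by move/pinj/eqP; apply/negP.
    lia.
  move=> _ h; have : index y sigma <> index a sigma by move/pinj/eqP; apply/negP.
  lia.
exists (b, a); first by rewrite inE /= Aba eab ltnSn.
by rewrite inE /= Aba !it /f tpermL tpermR eab; lia.
Qed.

(** * The game as a linear map *)

Section LightsOut.
Local Open Scope ring_scope.
Variables (T : finType) (A : rel T).

Definition toggle_effect (R : pzRingType) (x : T -> R) (w : T) : R :=
  \sum_v ((v == w) || A v w)%:R * x v.

Lemma foldl_toggle k (f : T -> 'Z_k) s w :
  foldl (@toggle T A k) f s w =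
  f w + toggle_effect (fun v => (count_mem v s)%:R) w.
Proof.
elim: s f => [|a s IH] f /=.
  by rewrite /toggle_effect big1 ?addr0 // => v _; rewrite mulr0.
rewrite IH /toggle.
have -> : toggle_effect (fun v => ((a == v) + count_mem v s)%:R : 'Z_k) w =
   ((a == w) || A a w)%:R + toggle_effect (fun v => (count_mem v s)%:R : 'Z_k) w.
  rewrite /toggle_effect (eq_bigr (fun v => ((v == w) || A v w)%:R * (a == v)%:R
     + ((v == w) || A v w)%:R * (count_mem v s)%:R)); last first.
    by move=> v _; rewrite natrD mulrDr.
  rewrite big_split /=; congr (_ + _).
  rewrite (bigD1 a) //= eqxx mulr1 big1 ?addr0 // => v va.
  by rewrite (eq_sym a) (negbTE va) mulr0.
by rewrite addrA (eq_sym w); case: ifP => _; rewrite ?addr0.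
Qed.

Lemma kAW_surjective k :
  kAW A k <-> forall g : T -> 'Z_k, exists x, toggle_effect x =1 g.
Proof.
split=> [h g|h f].
  have [s hs] := h (fun w => - g w).
  exists (fun v => (count_mem v s)%:R) => w.
  by have /eqP := hs w; rewrite foldl_toggle addrC subr_eq0 => /eqP.
have [x hx] := h (fun w => - f w).
(* The order of toggles is irrelevant, so each [v] is listed as often as the natural representative
   of [x v] prescribes. *)
exists (flatten [seq nseq (x v) v | v <- enum T]) => w.
rewrite foldl_toggle -[f w]opprK -hx addrC; apply/eqP; rewrite subr_eq0; apply/eqP.
apply: eq_bigr => v _; congr (_ * _).
rewrite count_flatten -map_comp sumnE big_map big_enum /=.
rewrite (bigD1 v) //= count_nseq /= eqxx mul1n big1 ?addn0 ?natr_Zp // => u uv.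
by rewrite count_nseq /= (negbTE uv).
Qed.

Lemma toggle_effectB (R : pzRingType) (x y : T -> R) w :
  toggle_effect (fun v => x v - y v) w = toggle_effect x w - toggle_effect y w.
Proof. by rewrite /toggle_effect -sumrB; apply: eq_bigr => v _; rewrite mulrBr. Qed.

(* An injective endomorphism of a finite group is onto. *)
Lemma toggle_effect_surj (R : finNzRingType) :
  (forall x : T -> R, toggle_effect x =1 (fun=> 0) -> x =1 (fun=> 0)) ->
  forall g : T -> R, exists x, toggle_effect x =1 g.
Proof.
move=> ker0 g.
pose F (x : {ffun T -> R}) : {ffun T -> R} := [ffun w => toggle_effect x w].
have Finj : injective F.
  move=> x y /ffunP e; apply/ffunP => v; apply/eqP; rewrite -subr_eq0; apply/eqP.
  apply: (ker0 (fun v => x v - y v)) => w.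
  by rewrite toggle_effectB; have := e w; rewrite !ffunE => ->; rewrite subrr.
have [G _ FK] := injF_bij Finj.
exists (G [ffun w => g w]) => w.
by have /ffunP/(_ w) := FK [ffun w => g w]; rewrite !ffunE.
Qed.

End LightsOut.

(** * Labels produced when the feedback arcs form a star *)

Section Star.
Variables (T : finType) (A : rel T) (sigma : seq T) (c : T).
Hypothesis tA : tournament A.
Hypothesis ord_sigma : is_ordering sigma.
Hypothesis min_sigma : min_fas A sigma.
Local Notation pos x := (index x sigma).
Local Notation S := (fas A sigma).
Hypothesis c_in_S : exists2 e, e \in S & ((e.1 == c) || (e.2 == c)).
Hypothesis S_star : forall e, e \in S -> (e.1 == c) (+) (e.2 == c).

Definition leaf_head w := (c, w) \in S.
Definition leaf_tail w := (w, c) \in S.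
Definition feedback_vertex w := head_fv S w || tail_fv S w.

Lemma leaf_head_pos w : leaf_head w -> (pos w).+1 < pos c.
Proof.
rewrite /leaf_head inE /= => /andP[Acw lt].
rewrite ltn_neqAle lt andbT; apply/eqP => e.
by have := min_fas_adjacent tA ord_sigma min_sigma (esym e); rewrite Acw.
Qed.

Lemma leaf_tail_pos w : leaf_tail w -> (pos c).+1 < pos w.
Proof.
rewrite /leaf_tail inE /= => /andP[Acw lt].
rewrite ltn_neqAle lt andbT; apply/eqP => e.
by have := min_fas_adjacent tA ord_sigma min_sigma (esym e); rewrite Acw.
Qed.

Lemma head_fv_star w : head_fv S w -> leaf_head w \/ w = c.
Proof.
case/existsP => v vw; have := S_star vw => /=.
have [e _|_ /= /eqP] := eqVneq v c; last by right.
by left; rewrite /leaf_head -e.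
Qed.

Lemma tail_fv_star w : tail_fv S w -> leaf_tail w \/ w = c.
Proof.
case/existsP => v vw; have := S_star vw => /=.
have [e _|ne /=] := eqVneq w c; first by right.
by move/eqP => e; left; rewrite /leaf_tail -e.
Qed.

Lemma feedback_vertexE w :
  feedback_vertex w = [|| w == c, leaf_head w | leaf_tail w].
Proof.
apply/orP/or3P => [[/head_fv_star|/tail_fv_star] [h|/eqP h]|].
- exact: Or32.
- exact: Or31.
- exact: Or33.
- exact: Or31.
case=> [/eqP ->|h|h].
- have [[u v] uvS /= /orP[/eqP e|/eqP e]] := c_in_S; [right|left].
    by apply/existsP; exists v; rewrite -e.
  by apply/existsP; exists u; rewrite -e.
- by left; apply/existsP; exists c.
- by right; apply/existsP; exists c.
Qed.

(** Head leaves lie at least two places before [c] and tail leaves at least two places after it, so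
    neither [c] nor a leaf of the other kind is next to a head leaf. *)
Lemma head_adjacent_closed : adjacent_closed sigma feedback_vertex (head_fv S).
Proof.
move=> x y /head_fv_star hy; rewrite feedback_vertexE /adjacent => qx adj.
case/or3P: qx => [/eqP xc|xh|/leaf_tail_pos xt].
- case: hy => [/leaf_head_pos|yc]; first by subst x; lia.
  by subst; lia.
- by apply/existsP; exists c.
- by case: hy => [/leaf_head_pos|yc]; [lia|subst; lia].
Qed.

Lemma tail_adjacent_closed : adjacent_closed sigma feedback_vertex (tail_fv S).
Proof.
move=> x y /tail_fv_star hy; rewrite feedback_vertexE /adjacent => qx adj.
case/or3P: qx => [/eqP xc|/leaf_head_pos xh|xt].
- case: hy => [/leaf_tail_pos|yc]; first by subst x; lia.
  by subst; lia.
- by case: hy => [/leaf_tail_pos|yc]; [lia|subst; lia].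
- by apply/existsP; exists c.
Qed.

Lemma num_feedback_intervalsE :
  num_feedback_intervals A sigma = #|[set w | run_start sigma feedback_vertex w]|.
Proof.
rewrite -(card_p_interval ord_sigma) /num_feedback_intervals.
apply: eq_card => I; rewrite !inE /feedback_interval.
by apply: p_intervalU; [|exact: head_adjacent_closed|exact: tail_adjacent_closed].
Qed.

Local Open Scope ring_scope.
Variables (R : comNzRingType) (x : T -> R).

(** The correction to prefix sums caused by the backward arc between [w] and [c]: 1 for a tail leaf,
    -1 for a head leaf, 0 otherwise. *)
Definition leaf_sign w : R := (leaf_tail w)%:R - (leaf_head w)%:R.

Definition prefix_sum n : R := \sum_v (pos v < n)%N%:R * x v.

Lemma prefix_sum0 : prefix_sum 0 = 0.
Proof. by rewrite /prefix_sum big1 // => v _; rewrite mul0r. Qed.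

Lemma prefix_sumS w : prefix_sum (pos w).+1 = prefix_sum (pos w) + x w.
Proof.
rewrite /prefix_sum (bigD1 w) //= ltnS leqnn mul1r.
rewrite [in RHS](bigD1 w) //= ltnn mul0r add0r addrC; congr (_ + _).
apply: eq_bigr => v vw; congr (_%:R * _).
rewrite ltnS leq_eqVlt; case: eqP => // /(pos_inj ord_sigma) e.
by rewrite e eqxx in vw.
Qed.

Lemma leaf_tail_center : leaf_tail c = false.
Proof. by apply/negP => /leaf_tail_pos; lia. Qed.

Lemma leaf_head_center : leaf_head c = false.
Proof. by apply/negP => /leaf_head_pos; lia. Qed.

Lemma arcE v w : v != w ->
  A v w = if (pos v < pos w)%N then (w, v) \notin S else (v, w) \in S.
Proof.
move=> vw; case: tA => _ /(_ _ _ vw); rewrite !inE /=.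
have : pos v <> pos w by move/(pos_inj ord_sigma)/eqP; apply/negP.
case: ltngtP => //= _ _; rewrite ?andbT //.
by case: (A v w); case: (A w v).
Qed.

(** If every arc went forward, the effect at [w] would be the prefix sum through [w]. All backward
    arcs meet [c], so only the term of [c] needs correcting. *)
Lemma toggle_effect_prefix w : w != c ->
  toggle_effect A x w = prefix_sum (pos w).+1 - leaf_sign w * x c.
Proof.
move=> wc; rewrite /toggle_effect /prefix_sum.
rewrite (bigD1 c) //= [in RHS](bigD1 c) //= (eq_sym c) (negbTE wc) /=.
rewrite [RHS]addrAC; congr (_ + _).
  rewrite -mulrBl; congr (_ * _).
  rewrite arcE 1?eq_sym // /leaf_sign /leaf_head /leaf_tail !inE /= ltnS.
  have : pos c <> pos w by move/(pos_inj ord_sigma)/eqP; rewrite eq_sym; apply/negP.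
  by case: ltngtP => //= _ _; rewrite ?andbF ?andbT; case: (A c w); case: (A w c) => /=; ring.
apply: eq_bigr => v vc; congr (_%:R * _); rewrite ltnS.
have [->|vw] := eqVneq v w; first by rewrite leqnn.
have nS a b : a != c -> b != c -> (a, b) \notin S.
  by move=> ac bc; apply/negP => /S_star /=; rewrite (negbTE ac) (negbTE bc).
rewrite /= arcE // (negbTE (nS _ _ vc wc)) (nS _ _ wc vc).
have : pos v <> pos w by move/(pos_inj ord_sigma)/eqP; apply/negP.
by case: ltngtP.
Qed.

Lemma toggle_effect_center :
  toggle_effect A x c = prefix_sum (pos c).+1 + \sum_v leaf_sign v * x v.
Proof.
rewrite /toggle_effect /prefix_sum -big_split /=; apply: eq_bigr => v _.
rewrite -mulrDl; congr (_ * _).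
have [->|vc] := eqVneq v c.
  by rewrite /leaf_sign leaf_head_center leaf_tail_center ltnS leqnn /=; ring.
rewrite /= arcE // /leaf_sign /leaf_head /leaf_tail !inE /= ltnS.
have : pos v <> pos c by move/(pos_inj ord_sigma)/eqP; apply/negP.
by case: ltngtP => //= _ _; rewrite ?andbF ?andbT; case: (A c v); case: (A v c) => /=; ring.
Qed.

Hypothesis x_off_center : forall w, w != c -> toggle_effect A x w = 0.

Lemma prefix_sum_off_center w : w != c ->
  prefix_sum (pos w).+1 = leaf_sign w * x c.
Proof.
move=> wc; have /eqP := toggle_effect_prefix wc.
by rewrite x_off_center // eq_sym subr_eq0 => /eqP.
Qed.

Lemma pos_pred w n : pos w = n.+1 -> exists y, pos y = n.
Proof.
by move=> e; apply: exists_pos => //; apply: ltn_trans (pos_lt ord_sigma w); rewrite e.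
Qed.

(** The predecessor of [c], if any, is not a leaf, so the prefix sum through it vanishes. *)
Lemma prefix_sum_center : prefix_sum (pos c) = 0.
Proof.
case e: (pos c) => [|n]; first exact: prefix_sum0.
have [y ey] := pos_pred e.
rewrite -ey prefix_sum_off_center; last by apply/eqP => yc; subst y; lia.
have /negbTE h : ~~ leaf_head y by apply/negP => /leaf_head_pos; lia.
have /negbTE t : ~~ leaf_tail y by apply/negP => /leaf_tail_pos; lia.
by rewrite /leaf_sign h t subrr mul0r.
Qed.

Lemma run_start_pred q w y : (pos y).+1 = pos w ->
  run_start sigma q w = q w && ~~ q y.
Proof.
move=> e; congr (_ && ~~ _); apply/existsP/idP => [[z /andP[qz /eqP ez]]|qy].
  by have <- : z = y by apply: (pos_inj ord_sigma); lia.
by exists y; rewrite qy e eqxx.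
Qed.

(* Within a run of leaves the prefix sums agree, so only the first leaf of a
   run contributes. *)
Lemma leaf_sign_mul v :
  (v == c)%:R * x c + leaf_sign v * x v =
  (run_start sigma feedback_vertex v)%:R * x c.
Proof.
have [->|vc] := eqVneq v c.
  rewrite /leaf_sign leaf_head_center leaf_tail_center subrr mul0r addr0.
  congr (_%:R * _); rewrite /run_start feedback_vertexE eqxx /=.
  apply/esym/eqP; rewrite eqb1; apply/existsPn => y; apply/negP.
  rewrite feedback_vertexE => /andP[/or3P[/eqP->|/leaf_head_pos|/leaf_tail_pos]]; lia.
rewrite mul0r add0r.
(* [x v] is the difference of two consecutive prefix sums, the later of which is known. *)
have xv : x v = leaf_sign v * x c - prefix_sum (pos v).
  by rewrite -prefix_sum_off_center // prefix_sumS [_ + x v]addrC addrK.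
have fv : feedback_vertex v = leaf_head v || leaf_tail v.
  by rewrite feedback_vertexE (negbTE vc).
have excl u : leaf_head u -> leaf_tail u = false.
  by move=> /leaf_head_pos h; apply/negP => /leaf_tail_pos; lia.
have [lv|/norP[/negbTE nh /negbTE nt]] := boolP (leaf_head v || leaf_tail v); last first.
  by rewrite /leaf_sign /run_start fv nh nt subrr !mul0r.
have sqr u : leaf_head u || leaf_tail u -> leaf_sign u * leaf_sign u = 1.
  by rewrite /leaf_sign; case/orP => [h|t];
    [rewrite h excl //|case: (boolP (leaf_head u)) => [/excl|_]; rewrite t //] => /=; ring.
(* A leaf in first position starts a run and has an empty prefix sum before it. *)
case e: (pos v) => [|n].
  have -> : run_start sigma feedback_vertex v.
    by rewrite /run_start fv lv; apply/existsPn => y; rewrite e andbF.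
  by rewrite xv e prefix_sum0 subr0 mulrA sqr.
have [y ey] := pos_pred e.
have yc : y != c.
  by apply/eqP => yc; subst y; case/orP: lv => [/leaf_head_pos|/leaf_tail_pos]; lia.
have eyv : (pos y).+1 = pos v by rewrite e ey.
rewrite (run_start_pred _ eyv) fv lv /= xv -eyv prefix_sum_off_center //.
rewrite feedback_vertexE (negbTE yc) /=.
have [ly|/norP[/negbTE nh /negbTE nt]] := boolP (leaf_head y || leaf_tail y); last first.
  by rewrite [leaf_sign y]/leaf_sign nh nt subrr mul0r subr0 mulrA sqr.
(* Consecutive leaves lie on the same side of [c], hence have equal signs, and the contribution of
   [v] cancels. *)
suff -> : leaf_sign y = leaf_sign v by rewrite subrr mulr0 mul0r.
case/orP: lv => [h|t]; case/orP: ly => [h'|t'].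
- by rewrite /leaf_sign h h' !excl.
- by move: (leaf_head_pos h) (leaf_tail_pos t'); lia.
- by move: (leaf_tail_pos t) (leaf_head_pos h'); lia.
- rewrite /leaf_sign t t'; case: (boolP (leaf_head y)) => [/excl|_]; rewrite ?t' //.
  by case: (boolP (leaf_head v)) => [/excl|_]; rewrite ?t.
Qed.

Lemma toggle_effect_center_num :
  toggle_effect A x c = (num_feedback_intervals A sigma)%:R * x c.
Proof.
rewrite toggle_effect_center prefix_sumS prefix_sum_center add0r.
(* The term [x c] is spread over an indicator sum, so that it enters as the contribution of the run
   consisting of [c] alone. *)
have xcE : x c = \sum_v (v == c)%:R * x c.
  by rewrite (bigD1 c) //= eqxx mul1r big1 ?addr0 // => v /negbTE ->; rewrite mul0r.
rewrite {1}xcE -big_split /= (eq_bigr _ (fun v _ => leaf_sign_mul v)) -mulr_suml.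
congr (_ * _); rewrite num_feedback_intervalsE -sum1_card natr_sum [RHS]big_mkcond /=.
by apply: eq_bigr => v _; rewrite inE; case: ifP.
Qed.

(** All prefix sums are multiples of [x c], and [x] is recovered from their differences. *)
Lemma center_zero : x c = 0 -> x =1 (fun=> 0).
Proof.
move=> xc.
have P0 v : prefix_sum (pos v).+1 = 0.
  have [->|vc] := eqVneq v c; first by rewrite prefix_sumS prefix_sum_center xc addr0.
  by rewrite prefix_sum_off_center // xc mulr0.
move=> v; have := prefix_sumS v; rewrite P0.
case e: (pos v) => [|n]; first by rewrite prefix_sum0 add0r.
by have [y <-] := pos_pred e; rewrite P0 add0r.
Qed.

End Star.

Theorem mainTheorem8 (T : finType) (A : rel T) (sigma : seq T) (k : nat) :
  tournament A -> strongly_connected A -> is_ordering sigma ->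
  min_fas A sigma -> directed_star (fas A sigma) -> 1 < k ->
  (kAW A k <-> coprime k (num_feedback_intervals A sigma)).
Proof.
move=> tA _ os mn [c [cS star _]] k1.
rewrite -(unitZpE _ k1); split.
  (* A preimage of the indicator of [c] satisfies the equations away from [c], and its value at [c]
     is an inverse of the number of intervals. *)
  move/kAW_surjective => /(_ (fun w => (w == c)%:R)%R) [x hx].
  have off w : w != c -> toggle_effect A x w = 0%R by rewrite hx => /negbTE ->.
  have := toggle_effect_center_num tA os mn cS star off.
  rewrite hx eqxx => e; apply/unitrP; exists (x c).
  by rewrite mulrC -e.
(* Conversely, a kernel element has [x c] killed by a unit, so [x c] is zero and the kernel is
   trivial. *)
move=> u; apply/kAW_surjective; apply: toggle_effect_surj => x x0.
have off w : w != c -> toggle_effect A x w = 0%R by rewrite x0.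
apply: (center_zero tA os mn star off).
have := toggle_effect_center_num tA os mn cS star off.
by rewrite x0 -[LHS](mulr0 (num_feedback_intervals A sigma)%:R%R) => /(mulrI u).
Qed.
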